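(* Let $\mathcal A$ be an $\mathbb F$-algebra and let $A\in\mathcal A$. Let $X\in\mathcal A$ be such that $$A^3X-[3]_qA^2XA+[3]_qAXA^2-XA^3=(q^2-q^{-2})^2(XA-AX).$$ Then $$(\mathrm{bad}\,A)_{r+1}(X^r)=0\qquad\text{for all integers } r\ge1.$$
   Context: Let $\mathbb F$ be a field and fix $0\neq q\in\mathbb F$ that is not a root of unity. Algebras are associative with $1$. Write $[n]_q=(q^n-q^{-n})/(q-q^{-1})$. For an $\mathbb F$-algebra $\mathcal A$, an element $A\in\mathcal A$ and $r\in\mathbb Z$, $\mathrm{ad}_rA:\mathcal A\to\mathcal A$ is the $\mathbb F$-linear map $X\mapsto q^rAX-q^{-r}XA$, and $\mathrm{ad}\,A=\mathrm{ad}_0A$. These maps mutually commute; products of maps are compositions and $I$ is the identity map. Define $$\mathrm{bad}_0A=\frac{\mathrm{ad}\,A}{q-q^{-1}},\qquad \mathrm{bad}_nA=\frac{(q^{2n}-q^{-2n})^2I+(\mathrm{ad}_nA)(\mathrm{ad}_{-n}A)}{(q^{2n}-q^{-2n})(q^{2n+1}-q^{-2n-1})}\quad(n\ge1),$$ $$(\mathrm{bad}\,A)_n=\prod_{i=0}^{n-1}\mathrm{bad}_iA\quad(n\ge0),\qquad(\mathrm{bad}\,A)_0=I.$$ *)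

(* Defs.v *)
From mathcomp Require Import all_boot all_order all_algebra.

Set Implicit Arguments.
Unset Strict Implicit.
Unset Printing Implicit Defensive.

Import GRing.Theory.
Local Open Scope ring_scope.

Definition qint (F : fieldType) (q : F) (n : nat) : F :=
  (q ^+ n - q ^- n) / (q - q^-1).

Definition not_root_of_unity (F : fieldType) (q : F) : Prop :=
  forall n : nat, (0 < n)%N -> q ^+ n != 1.

(* The exponent of _ ^ _ is a (possibly negative) integer, whereas
   q ^+ m and q ^- m have a natural number m and denote the m-th power of q
   and its inverse. *)
Definition ad (F : fieldType) (alg : algType F) (q : F) (r : int) (A : alg)
    : alg -> alg :=
  fun X => q ^ r *: (A * X) - q ^ (- r) *: (X * A).

Definition bad (F : fieldType) (alg : algType F) (q : F) (n : nat) (A : alg)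
    : alg -> alg :=
  if n is 0%N then (q - q^-1)^-1 \*: ad q 0 A
  else ((q ^+ (2 * n) - q ^- (2 * n)) *
        (q ^+ (2 * n + 1) - q ^- (2 * n + 1)))^-1 \*:
       (((q ^+ (2 * n) - q ^- (2 * n)) ^+ 2 \*: idfun)
          \+ (ad q n%:Z A \o ad q (- n%:Z) A)).

(* The product of maps is composition; the maps bad q i A commute pairwise, so
   the order of the factors is immaterial. *)
Definition bad_prod (F : fieldType) (alg : algType F) (q : F) (n : nat)
    (A : alg) : alg -> alg :=
  \big[(fun f g : alg -> alg => f \o g)/idfun]_(0 <= i < n) bad q i A.

(* Main.v *)
From HB Require Import structures.
Require Import Defs.
From mathcomp Require Import all_boot all_order all_algebra.
From mathcomp Require Import ring zify.

(** Write x for left and y for right multiplication by A.  These commute, so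
polynomials p(x, y) act on the algebra, and up to a scalar (bad A)_(r+1) is the
action of

  F_r(x, y) = (y - x) P_1(x, y) ... P_r(x, y),
  P_n(x, y) = y^2 - (q^(2n) + q^(-2n)) x y + x^2 + (q^(2n) - q^(-2n))^2.

The hypothesis on X says that F_1 annihilates X, and the conclusion that F_r
annihilates X^r.  Put theta(s) = s + s^-1.  Then

  P_n(theta(s), y) = (y - theta(q^(2n) s)) (y - theta(q^(-2n) s)),

so F_r(theta(s), y) has the 2r+1 roots y = theta(q^(2k) s) with |k| <= r: if A
were diagonalizable, F_r would annihilate U exactly when U connects only
eigenvalues whose parameters s differ by a factor q^(2k) with |k| <= r.  Under
products these bounds on |k| add up, which is the whole reason for the theorem.

For an arbitrary A the same argument is carried by polynomials in three
variables: x, y, z stand for multiplication by A to the left of U, between U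
and V, and to the right of V in the product U V.  It suffices that F_(r+1)(x, z)
lies in the ideal of F[x, y, z] generated by F_r(x, y) and F_1(y, z)
(bad_poly_compose): then F_r U = 0 and F_1 V = 0 imply F_(r+1) (U V) = 0
(act_bad_poly_mul), and induction on r concludes.

The generators of this ideal are monic in y and in z respectively, so
F_(r+1)(x, z) has a remainder of degree at most 2r in y and at most 2 in z
modulo them.  At x = theta(q^m) with m large the generators have 2r+1 common values of
y, each followed by 3 values of z, all distinct, and F_(r+1)(x, z) vanishes at
all of these points; hence so does the remainder, which is therefore 0 at that
x.  As q is not a root of unity, there are infinitely many such x in F itself,
so the remainder is 0. *)

Set Implicit Arguments.
Unset Strict Implicit.
Unset Printing Implicit Defensive.

Import GRing.Theory.
Local Open Scope ring_scope.

(** * Polynomials acting by left and right multiplication *)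

Section Sandwich.
Variables (F : fieldType) (alg : algType F) (A : alg).

(** The powers of the variable multiply W on the right by powers of A, while the
coefficients act on the left through h.  Iterating this construction along the
tower F[x], F[x][y], F[x][y][z] gives the actions in two and three variables
below. *)
Definition sandwich (S : nzRingType) (h : {additive S -> alg}) (W : alg)
    (p : {poly S}) : alg :=
  \sum_(k < size p) h p`_k * W * A ^+ k.

Lemma sandwich_widen (S : nzRingType) (h : {additive S -> alg}) (W : alg)
    (p : {poly S}) (n : nat) :
  (size p <= n)%N -> sandwich h W p = \sum_(k < n) h p`_k * W * A ^+ k.
Proof.
move=> le_pn; rewrite /sandwich.
rewrite (big_ord_widen _ (fun k => h p`_k * W * A ^+ k) le_pn).
rewrite big_mkcond; apply: eq_bigr => k _; case: ltnP => // le_pk.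
by rewrite nth_default // raddf0 !mul0r.
Qed.

Lemma sandwich_is_zmod_morphism (S : nzRingType) (h : {additive S -> alg})
    (W : alg) :
  zmod_morphism (sandwich h W).
Proof.
move=> p p'; pose n := maxn (size p) (size p').
have le_pp' : (size (p - p')%R <= n)%N.
  by rewrite (leq_trans (size_polyD _ _)) // size_polyN.
rewrite (sandwich_widen h W le_pp').
rewrite (sandwich_widen h W (leq_maxl (size p) (size p'))).
rewrite (sandwich_widen h W (leq_maxr (size p) (size p'))) -sumrB.
by apply: eq_bigr => k _; rewrite coefB raddfB !mulrBl.
Qed.

HB.instance Definition _ (S : nzRingType) (h : {additive S -> alg}) (W : alg) :=
  GRing.isZmodMorphism.Build {poly S} alg (sandwich h W)
    (sandwich_is_zmod_morphism h W).

Lemma sandwichC (S : nzRingType) (h : {additive S -> alg}) (W : alg) (c : S) :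
  sandwich h W c%:P = h c * W.
Proof.
rewrite (sandwich_widen h W (size_polyC_leq1 c)) big_ord1 coefC eqxx.
by rewrite expr0 mulr1.
Qed.

Lemma sandwichMX (S : nzRingType) (h : {additive S -> alg}) (W : alg)
    (p : {poly S}) :
  sandwich h W (p * 'X) = sandwich h W p * A.
Proof.
have le_pX : (size (p * 'X)%R <= (size p).+1)%N.
  by rewrite (leq_trans (size_polyMleq _ _)) // size_polyX addn2.
rewrite (sandwich_widen h W le_pX) big_ord_recl coefMX raddf0 !mul0r add0r.
rewrite mulr_suml; apply: eq_bigr => k _.
by rewrite coefMX /= exprSr mulrA.
Qed.

(** The outer variable y is right multiplication by A, the inner variable x is
left multiplication: x^i y^j sends W to A^i W A^j. *)
Definition act (W : alg) : {poly {poly F}} -> alg :=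
  sandwich (horner_alg A) W.

HB.instance Definition _ (W : alg) := GRing.Additive.on (act W).

Lemma actC (W : alg) (c : {poly F}) : act W c%:P = horner_alg A c * W.
Proof. exact: sandwichC. Qed.

Lemma actMX (W : alg) (p : {poly {poly F}}) : act W (p * 'X) = act W p * A.
Proof. exact: sandwichMX. Qed.

Lemma actCM (W : alg) (c : {poly F}) (p : {poly {poly F}}) :
  act W (c%:P * p) = horner_alg A c * act W p.
Proof.
elim/poly_ind: p => [|p d IHp]; first by rewrite mulr0 !raddf0 mulr0.
rewrite mulrDr mulrA -polyCM !raddfD /= mulrDr !actMX !actC IHp.
by rewrite rmorphM !mulrA.
Qed.

(** Left and right multiplications commute, so the action is one of a
commutative ring, and products of polynomials act as composites. *)
Lemma actM (W : alg) (p p' : {poly {poly F}}) :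
  act W (p * p') = act (act W p') p.
Proof.
elim/poly_ind: p => [|p d IHp]; first by rewrite mul0r !raddf0.
rewrite mulrDl !raddfD /= actCM -mulrA ['X * _]mulrC mulrA.
by rewrite !actMX actC IHp.
Qed.

Lemma actZ (W : alg) (a : F) (p : {poly {poly F}}) :
  act (a *: W) p = a *: act W p.
Proof.
rewrite /act /sandwich scaler_sumr; apply: eq_bigr => k _.
by rewrite -scalerAr -scalerAl.
Qed.

Lemma act0 (p : {poly {poly F}}) : act 0 p = 0.
Proof. by apply: big1 => k _; rewrite mulr0 mul0r. Qed.

(** The value of x^i y^j z^k is A^i U A^j V A^k, where x is the innermost variable
and z the outermost one. *)
Definition act2 (U V : alg) : {poly {poly {poly F}}} -> alg :=
  sandwich (act U) V.

HB.instance Definition _ (U V : alg) := GRing.Additive.on (act2 U V).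

Lemma act2C (U V : alg) (c : {poly {poly F}}) : act2 U V c%:P = act U c * V.
Proof. exact: sandwichC. Qed.

Lemma act2MX (U V : alg) (p : {poly {poly {poly F}}}) :
  act2 U V (p * 'X) = act2 U V p * A.
Proof. exact: sandwichMX. Qed.

(** A polynomial d in y alone contributes a factor d(A) at the right of U. *)
Lemma act_mul_inner (U : alg) (c : {poly {poly F}}) (d : {poly F}) :
  act U (c * map_poly polyC d) = act U c * horner_alg A d.
Proof.
elim/poly_ind: d => [|d a IHd]; first by rewrite !raddf0 mulr0 mulr0 raddf0.
rewrite !rmorphD !rmorphM /= map_polyX map_polyC /= !mulrDr raddfD /=.
rewrite mulrA actMX IHd horner_algX horner_algC mulrA.
by rewrite [c * _]mulrC actCM horner_algC mulr_algl mulr_algr.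
Qed.

(** The embedding of f turns f(x, y) into f(y, z), which only involves the two
places around V; the remaining factor Q only adds powers of A around f V. *)
Lemma act2_mul_right (U V : alg) (Q : {poly {poly {poly F}}})
    (f : {poly {poly F}}) :
  act V f = 0 -> act2 U V (Q * map_poly (map_poly polyC) f) = 0.
Proof.
move=> fV0.
have act2CM c g :
    act2 U V (c%:P * map_poly (map_poly polyC) g) = act U c * act V g.
  elim/poly_ind: g => [|g d IHg]; first by rewrite !raddf0 mulr0 raddf0 mulr0.
  rewrite !rmorphD !rmorphM /= map_polyX map_polyC /= mulrDr mulrA -polyCM.
  rewrite !raddfD /= mulrDr act2MX actMX act2C actC IHg.
  by rewrite act_mul_inner !mulrA.
elim/poly_ind: Q => [|Q c IHQ]; first by rewrite mul0r raddf0.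
rewrite mulrDl raddfD /= act2CM fV0 mulr0 addr0 -mulrA ['X * _]mulrC mulrA.
by rewrite act2MX IHQ mul0r.
Qed.

(** The embedding of g turns g(x, y) into g(x, z), which leaves the place between U
and V alone. *)
Lemma act2_outer (U V : alg) (g : {poly {poly F}}) :
  act2 U V (map_poly polyC g) = act (U * V) g.
Proof.
elim/poly_ind: g => [|g d IHg]; first by rewrite !raddf0.
rewrite !rmorphD !rmorphM /= map_polyX map_polyC /= !raddfD /=.
by rewrite act2MX actMX act2C !actC IHg mulrA.
Qed.

(** With z-coefficients in the annihilator of U, nothing is left for V. *)
Lemma act2_eq0 (U V : alg) (R : {poly {poly {poly F}}}) :
  (forall k, act U R`_k = 0) -> act2 U V R = 0.
Proof.
by move=> RU0; rewrite /act2 /sandwich big1 // => k _; rewrite /= RU0 !mul0r.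
Qed.

End Sandwich.

Arguments act {F alg} A W.
Arguments act2 {F alg} A U V.

(** * The polynomials F_r and their zeros *)

Section BadPoly.
Variables (F : fieldType) (q : F).
Hypotheses (q_neq0 : q != 0) (q_nroot : not_root_of_unity q).

(** The points theta(q^k); restricting to powers of q keeps all of them in F. *)
Definition node (k : nat) : F := q ^+ k + q ^- k.

(** The equation theta(s) = theta(t) forces s = t or s t = 1, and distinct powers
of q with natural exponents satisfy neither. *)
Lemma node_inj : injective node.
Proof.
suff lt_neq a b : (a < b)%N -> node a <> node b.
  move=> a b eq_ab; case: (ltngtP a b) => // ltab.
    by case: (lt_neq _ _ ltab).
  by case: (lt_neq _ _ ltab).
move=> ltab; rewrite -(subnKC (ltnW ltab)).
have : (0 < b - a)%N by rewrite subn_gt0.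
move: (b - a)%N => d d_gt0 /eqP; apply/negP; rewrite /node -subr_eq0.
have qa0 : q ^+ a != 0 by rewrite expf_neq0.
have qd0 : q ^+ d != 0 by rewrite expf_neq0.
have -> : q ^+ a + q ^- a - (q ^+ (a + d) + q ^- (a + d))
        = (q ^+ d - 1) * (1 - q ^+ (a + a + d)) / q ^+ (a + d).
  rewrite !exprD; field.
  by rewrite qa0 qd0.
rewrite !mulf_neq0 ?invr_neq0 ?expf_neq0 // subr_eq0 ?q_nroot //.
by rewrite eq_sym q_nroot // addn_gt0 d_gt0 orbT.
Qed.

(** The polynomial P_n, with y the outer and x the inner variable; the index 0
stands for y - x, which has the sign opposite to ad A so as to be monic. *)
Definition bad_factor (n : nat) : {poly {poly F}} :=
  if n is 0%N then 'X - 'X%:P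
  else 'X^2 - ((q ^+ (2 * n) + q ^- (2 * n)) *: 'X)%:P * 'X
       + ('X^2 + ((q ^+ (2 * n) - q ^- (2 * n)) ^+ 2)%:P)%:P.

Definition bad_poly (r : nat) : {poly {poly F}} :=
  \prod_(0 <= i < r.+1) bad_factor i.

Lemma bad_factor_monic_size n :
  (bad_factor n \is monic) * (size (bad_factor n) = (n != 0%N).+2).
Proof.
case: n => [|n]; first by rewrite monicXsubC size_XsubC.
rewrite /bad_factor.
set b := (_ *: 'X); set c := ('X^2 + _%:P); rewrite -addrA.
have sz : (size (- (b%:P * 'X) + c%:P)%R < size ('X^2 : {poly {poly F}}))%N.
  rewrite size_polyXn ltnS -mulNr -polyCN.
  rewrite size_MXaddC; case: ifP => // _.
  exact: size_polyC_leq1.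
split; last by rewrite size_polyDl // size_polyXn.
by rewrite monicE lead_coefDl // lead_coefXn.
Qed.

Lemma bad_poly_monic r : bad_poly r \is monic.
Proof. by apply: monic_prod => i _; case: (bad_factor_monic_size i). Qed.

Lemma bad_polyS r : bad_poly r.+1 = bad_poly r * bad_factor r.+1.
Proof. by rewrite /bad_poly big_nat_recr. Qed.

Lemma size_bad_poly r : size (bad_poly r) = (r + r).+2.
Proof.
elim: r => [|r IHr]; first by rewrite /bad_poly big_nat1 bad_factor_monic_size.
have [mf sf] := bad_factor_monic_size r.+1.
rewrite bad_polyS size_monicM ?bad_poly_monic ?monic_neq0 // IHr sf.
lia.
Qed.

(** The factorization of P_n(theta(s), y) into (y - theta(q^(2n) s)) and
(y - theta(q^(-2n) s)), evaluated at powers of q. *)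
Lemma bad_factor_node n a b : (b = a + 2 * n \/ a = b + 2 * n)%N ->
  (bad_factor n).[(node b)%:P].[node a] = 0.
Proof.
case: n => [|n]; first by rewrite !addn0; case=> ->; rewrite !hornerE subrr.
rewrite /bad_factor /node; move: (2 * n.+1)%N => m.
have qm0 : q ^+ m != 0 by rewrite expf_neq0.
have qa0 : q ^+ a != 0 by rewrite expf_neq0.
have qb0 : q ^+ b != 0 by rewrite expf_neq0.
by case=> ->; rewrite !hornerE !exprD /=; field; rewrite ?qm0 ?qa0 ?qb0.
Qed.

Lemma bad_poly_node r n a b : (n <= r)%N ->
  (b = a + 2 * n \/ a = b + 2 * n)%N ->
  (bad_poly r).[(node b)%:P].[node a] = 0.
Proof.
move=> le_nr ab; rewrite /bad_poly big_mkord.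
rewrite (bigD1 (Ordinal (le_nr : n < r.+1)%N)) //= !hornerM.
by rewrite bad_factor_node // mul0r.
Qed.

(** Steps of 2 in the exponent match the factors q^(2k) relating the zeros of the
polynomials F_r. *)
Lemma poly_eq0_at (p : {poly F}) (n m : nat) : (size p <= n)%N ->
  (forall i, (i < n)%N -> p.[node (m + 2 * i)] = 0) -> p = 0.
Proof.
move=> le_pn p0; pose rs := [seq node (m + 2 * i) | i <- iota 0 n].
apply: (@roots_geq_poly_eq0 _ p rs); last by rewrite size_map size_iota.
  by apply/allP => x /mapP[i]; rewrite mem_iota => /= lt_in ->; apply/rootP/p0.
rewrite map_inj_uniq ?iota_uniq // => i j /node_inj/eqP.
by rewrite eqn_add2l eqn_pmul2l // => /eqP.
Qed.

Lemma horner2 (p : {poly {poly F}}) (a b : F) :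
  (map_poly (horner_eval a) p).[b] = p.[b%:P].[a].
Proof.
by rewrite -[RHS]/(horner_eval a _) -horner_map /= horner_evalE hornerC.
Qed.

(** * The three-variable ideal *)

(** The ideal is generated by F_1(y, z) and F_r(x, y), and R collects the multiples of the latter.  All zeros of the two
generators are visible on the grid x = theta(q^(M+2+2r)),
y = theta(q^(M+2+2i)), z = theta(q^(M+2i+2j)) with i <= 2r and j <= 2, whose
exponents are shifted so as to be natural numbers. *)
Lemma bad_poly_compose (r : nat) :
  exists2 R : {poly {poly {poly F}}},
    exists Q, map_poly polyC (bad_poly r.+1)
              = Q * map_poly (map_poly polyC) (bad_poly 1) + R
  & forall k, exists c, R`_k = c * bad_poly r.
Proof.
set G := map_poly polyC (bad_poly r.+1).
set f := map_poly (map_poly polyC) (bad_poly 1).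
have f_monic : f \is monic by exact: monic_map _ (bad_poly_monic 1).
have size_f : size f = 4%N.
  rewrite size_map_inj_poly ?size_bad_poly ?raddf0 //.
  exact: map_inj_poly polyC_inj (erefl _).
have f_div := Pdiv.IdomainMonic.divp_eq f_monic G.
exists (G %% f); first by exists (G %/ f).
set R := G %% f in f_div *; set Q := G %/ f in f_div.
have size_R : (size R <= 3)%N by rewrite -ltnS -size_f ltn_modp monic_neq0.
(* At a fixed pair (x, y) of the grid, R is a polynomial of degree at most 2 in
   z with three zeros, so each of its z-coefficients vanishes at (x, y). *)
have R_node M i k : (i < (r + r).+1)%N ->
    (R`_k).[(node (M + 2 + 2 * i))%:P].[node (M + 2 + 2 * r)] = 0.
  move=> lt_i; set b := node _; set a := node _.
  pose phi : {rmorphism {poly {poly F}} -> F} :=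
    horner_eval a \o horner_eval b%:P.
  suff rho0 : map_poly phi R = 0.
    by have := coef_map phi R k; rewrite rho0 coef0 /= /horner_eval => <-.
  apply: (@poly_eq0_at _ 3 (M + 2 * i)).
    exact: leq_trans (size_poly _ _) size_R.
  move=> j lt_j; set c := node _.
  have -> : map_poly phi R = map_poly phi G - map_poly phi Q * map_poly phi f.
    by rewrite f_div rmorphD rmorphM addrAC subrr add0r.
  have phiG : (map_poly phi G).[c] = (bad_poly r.+1).[c%:P].[a].
    rewrite -horner2 -map_poly_comp; congr (_.[c]); apply: eq_map_poly => d /=.
    by rewrite /horner_eval hornerC.
  have phif : (map_poly phi f).[c] = (bad_poly 1).[c%:P].[b].
    rewrite -horner2 -map_poly_comp; congr (_.[c]); apply: eq_map_poly => d /=.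
    by rewrite /horner_eval horner_map /= hornerC.
  rewrite hornerD hornerN hornerM phiG phif /a /b /c.
  (* The sum of the two truncated differences is the distance between r+1 and
     i+j, half of the distance between the exponents of x and z. *)
  rewrite (@bad_poly_node r.+1 ((r.+1 - (i + j)) + (i + j - r.+1))); try lia.
  rewrite (@bad_poly_node 1 ((1 - j) + (j - 1))); try lia.
  by rewrite mulr0 subrr.
move=> k; exists (R`_k %/ bad_poly r).
rewrite [LHS](Pdiv.IdomainMonic.divp_eq (bad_poly_monic r)).
set d := R`_k %% bad_poly r.
suff -> : d = 0 by rewrite addr0.
have size_d : (size d <= (r + r).+1)%N.
  by rewrite -ltnS -size_bad_poly ltn_modp monic_neq0 ?bad_poly_monic.
(* For each x of the grid, d has degree at most 2r in y and vanishes at the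
   2r+1 values of y; and M, hence x, takes arbitrarily many values. *)
apply/polyP => l; rewrite coef0.
apply: (@poly_eq0_at _ (size d`_l) (2 + 2 * r) (leqnn _)) => t _.
have -> : (2 + 2 * r + 2 * t = 2 * t + 2 + 2 * r)%N by lia.
set a := node _.
suff d_a0 : map_poly (horner_eval a) d = 0.
  by move: (coef_map (horner_eval a) d l); rewrite d_a0 coef0 /horner_eval.
apply: (@poly_eq0_at _ (r + r).+1 (2 * t + 2)).
  exact: leq_trans (size_poly _ _) size_d.
move=> i lt_i; rewrite horner2.
move: (R_node (2 * t)%N i k lt_i); rewrite -/a.
rewrite {1}(Pdiv.IdomainMonic.divp_eq (bad_poly_monic r) R`_k) -/d.
rewrite !hornerD !hornerM.
rewrite (@bad_poly_node r ((r - i) + (i - r))); try lia.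
by rewrite mulr0 add0r.
Qed.

(** * From polynomials to the maps bad *)

Variables (alg : algType F) (A : alg).

Lemma act_bad_poly_mul (r : nat) (U V : alg) :
  act A U (bad_poly r) = 0 -> act A V (bad_poly 1) = 0 ->
  act A (U * V) (bad_poly r.+1) = 0.
Proof.
move=> U0 V0; have [R [Q def_G] R_dvd] := bad_poly_compose r.
rewrite -act2_outer def_G raddfD /= act2_mul_right // add0r.
by apply: act2_eq0 => k; have [c ->] := R_dvd k; rewrite actM U0 act0.
Qed.

(** The composite of x q^n - y q^(-n) and x q^(-n) - y q^n; the scalar summand is
the remaining part of P_n. *)
Lemma ad_nN_expand (n : nat) (W : alg) :
  (q ^+ (2 * n) - q ^- (2 * n)) ^+ 2 *: W + ad q n%:Z A (ad q (- n%:Z) A W)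
  = W * A ^+ 2 - (q ^+ (2 * n) + q ^- (2 * n)) *: (A * W * A) + A ^+ 2 * W
    + (q ^+ (2 * n) - q ^- (2 * n)) ^+ 2 *: W.
Proof.
rewrite [LHS]addrC; congr (_ + _); rewrite /ad opprK -exprnN -exprnP.
rewrite !mulrBr !mulrBl !scalerBr -!scalerAr -!scalerAl !scalerA.
have q0 : q ^+ n != 0 by rewrite expf_neq0.
rewrite !mulfV ?mulVf // !scale1r mulnC exprM expr2 invfM.
rewrite opprB [RHS]addrC scalerDl opprD expr2 !mulrA -!addrA.
by congr (_ + _); rewrite addrCA.
Qed.

Lemma act_bad_factor0 (W : alg) : act A W (bad_factor 0) = W * A - A * W.
Proof.
by rewrite /bad_factor raddfB /= -['X]mul1r actMX -polyC1 !actC rmorph1 mul1r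
           horner_algX.
Qed.

Lemma act_bad_factorS (n : nat) (W : alg) :
  act A W (bad_factor n.+1)
  = W * A ^+ 2 - (q ^+ (2 * n.+1) + q ^- (2 * n.+1)) *: (A * W * A)
    + A ^+ 2 * W + (q ^+ (2 * n.+1) - q ^- (2 * n.+1)) ^+ 2 *: W.
Proof.
rewrite /bad_factor; move: (q ^+ _ + _) ((q ^+ _ - _) ^+ 2) => s t.
have -> : 'X^2 = 1%:P * 'X * 'X :> {poly {poly F}} by rewrite mul1r expr2.
rewrite !raddfD raddfN /= !actMX !actC /= rmorph1 mul1r linearZ rmorphXn /=.
rewrite !horner_algX horner_algC -!scalerAl mul1r.
by rewrite mul1r expr2 !mulrA -!addrA.
Qed.

Lemma bad_act (n : nat) (W : alg) :
  exists c, bad q n A W = c *: act A W (bad_factor n).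
Proof.
case: n => [|n].
  exists (- (q - q^-1)^-1); rewrite act_bad_factor0 /bad /= /ad oppr0 expr0z.
  by rewrite !scale1r scaleNr -scalerN opprB.
by eexists; rewrite act_bad_factorS -ad_nN_expand /bad /=.
Qed.

Lemma bad_prod_act (n : nat) (W : alg) :
  exists c, bad_prod q n.+1 A W = c *: act A W (bad_poly n).
Proof.
rewrite /bad_prod /bad_poly; elim: (index_iota 0 n.+1) => [|i s [c IHs]].
  by exists 1; rewrite !big_nil -polyC1 actC rmorph1 mul1r scale1r.
rewrite !big_cons /= IHs.
have [d ->] := bad_act i (c *: act A W (\prod_(j <- s) bad_factor j)).
by exists (d * c); rewrite actZ scalerA actM.
Qed.

(** With [3] = q^2 + 1 + q^(-2), the cubic relation is the expansion of
(y - x) P_1(x, y) X = 0. *)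
Lemma act_bad_poly1 (X : alg) :
  A ^+ 3 * X - qint q 3 *: (A ^+ 2 * X * A)
    + qint q 3 *: (A * X * A ^+ 2) - X * A ^+ 3
  = (q ^+ 2 - q ^- 2) ^+ 2 *: (X * A - A * X) ->
  act A X (bad_poly 1) = 0.
Proof.
move=> hX; rewrite /bad_poly !big_nat_recl // big_geq // mulr1 actM.
rewrite act_bad_factor0 act_bad_factorS.
have q2 : q ^+ 2 - 1 != 0 by rewrite subr_eq0 q_nroot.
have def_q3 : qint q 3 = q ^+ 2 + q ^- 2 + 1.
  rewrite /qint; field; rewrite q_neq0 /= -expr2.
  by rewrite q2.
move: hX; rewrite def_q3 muln1; move: (q ^+ 2 + _) ((q ^+ 2 - _) ^+ 2) => s t.
rewrite scalerBr => hX.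
rewrite !mulrDl !mulrDr mulNr mulrN -!scalerAl -!scalerAr.
have -> : t *: (X * A) = A ^+ 3 * X - (s + 1) *: (A ^+ 2 * X * A)
    + (s + 1) *: (A * X * A ^+ 2) - X * A ^+ 3 + t *: (A * X).
  by rewrite hX subrK.
rewrite !scalerDl !scale1r !exprS !expr0 !mulr1 !mulrA.
rewrite !opprD !opprK !addrA.
(* The 14 summands cancel in pairs; the permutation puts each next to its
   opposite. *)
rewrite (ACl (1*9*2*7*3*6*4*13*5*12*8*11*10*14))%AC /=.
by rewrite !(subrr, addNr, add0r).
Qed.

End BadPoly.

Theorem theorem6p1 (F : fieldType) (q : F) (q_neq0 : q != 0)
    (q_nroot : not_root_of_unity q) (alg : algType F) (A X : alg)
    (hX : A ^+ 3 * X - qint q 3 *: (A ^+ 2 * X * A)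
            + qint q 3 *: (A * X * A ^+ 2) - X * A ^+ 3
          = (q ^+ 2 - q ^- 2) ^+ 2 *: (X * A - A * X))
    (r : nat) (hr : (1 <= r)%N) :
  bad_prod q r.+1 A (X ^+ r) = 0.
Proof.
have [c ->] := bad_prod_act q_neq0 A r (X ^+ r).
suff -> : act A (X ^+ r) (bad_poly q r) = 0 by rewrite scaler0.
have X0 := act_bad_poly1 q_neq0 q_nroot hX.
(* The induction may start at the exponent 0, where (y - x) 1 = A - A = 0. *)
elim: r {hr c} => [|r IHr]; last by rewrite exprSr act_bad_poly_mul.
by rewrite expr0 /bad_poly big_nat1 act_bad_factor0 mul1r mulr1 subrr.
Qed.
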